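(* In the first Heisenberg group $\mathbb{H}^1=\mathbb{R}^3$, define \[\Lambda:=\{(x,y,t)\in\mathbb{H}^1: |t|\le |(x,y)|\}\] and \[P_e:=\Lambda\cap\Big(\{0\}\cup\bigcup_{n=1}^{\infty}\bigcup_{k=0}^{2^n-1}\{(x,y,t)\in\mathbb{H}^1: |(x,y)|\in A_{n,k}\}\Big),\] where $A_{n,k}:=(2^{-n}+k2^{-2n})+2^{-2n}C$, $C\subset[0,1]$ is the middle third Cantor set, and $|(x,y)|$ is the Euclidean norm on $\mathbb{R}^2$. Then $P_e$ is porous with respect to the Euclidean distance on $\mathbb{R}^3$, but $P_e$ is not porous at the point $0$ with respect to the Carnot–Carathéodory distance on $\mathbb{H}^1$.
   Context: For $\alpha,\beta\in\mathbb{R}$ and $S\subset\mathbb{R}$, $\alpha+\beta S=\{\alpha+\beta s:s\in S\}$. The first Heisenberg group $\mathbb{H}^1$ is $\mathbb{R}^3$ with the group law $(x,y,t)(x',y',t')=(x+x',\,y+y',\,t+t'-2(xy'-yx'))$. It is a Carnot group of step 2 with horizontal layer $V_1$ spanned by the left-invariant vector fields $X=\partial_x+2y\,\partial_t$ and $Y=\partial_y-2x\,\partial_t$. An absolutely continuous curve $\gamma:[a,b]\to\mathbb{H}^1$ is horizontal if $\gamma'(s)=u_1(s)X(\gamma(s))+u_2(s)Y(\gamma(s))$ for a.e. $s$ with $u_1,u_2\in L^1[a,b]$; its length is $\int_a^b|(u_1(s),u_2(s))|\,ds$. The Carnot–Carathéodory (CC) distance between two points is the infimum of lengths of horizontal curves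 joining them. Porosity: let $(M,d)$ be a metric space, $E\subset M$, $B(x,r)$ the open ball. For $\lambda\in(0,1)$ and $a\in E$, $E$ is $\lambda$-porous at $a$ if there is a sequence of points $x_j\in M\setminus\{a\}$ with $x_j\to a$ and $B(x_j,\lambda d(x_j,a))\cap E=\varnothing$ for every $j$. $E$ is porous at $a$ if it is $\lambda$-porous at $a$ for some $\lambda\in(0,1)$. $E$ is porous if there is $\lambda\in(0,1)$ (independent of the point) such that $E$ is $\lambda$-porous at every $a\in E$. *)

(* Defs.v *)
From mathcomp Require Import all_boot all_order all_algebra.
From mathcomp Require Import ring.
From mathcomp Require Import all_classical all_reals all_analysis.

Set Implicit Arguments.
Unset Strict Implicit.
Unset Printing Implicit Defensive.

Import Order.TTheory GRing.Theory Num.Theory.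
Import numFieldNormedType.Exports.

Local Open Scope classical_set_scope.
Local Open Scope ring_scope.

(* The distance is an explicit argument because two distances are put on the
   same carrier. Convergence [x_ j -> a] is convergence in the distance [d]. *)
Definition lporous_at (R : realType) (T : Type) (d : T -> T -> R)
    (E : set T) (lambda : R) (a : T) : Prop :=
  exists x_ : nat -> T,
    [/\ forall j, x_ j <> a,
        (fun j => d (x_ j) a) @ \oo --> (0 : R) &
        forall j, [set y | d (x_ j) y < lambda * d (x_ j) a] `&` E = set0].

Definition porous_at (R : realType) (T : Type) (d : T -> T -> R)
    (E : set T) (a : T) : Prop :=
  exists lambda : R, 0 < lambda < 1 /\ lporous_at d E lambda a.

Definition porous (R : realType) (T : Type) (d : T -> T -> R)
    (E : set T) : Prop :=
  exists lambda : R, 0 < lambda < 1 /\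
    forall a, E a -> lporous_at d E lambda a.

(* A point (x, y, t) is a nested pair [p] with x = [p.1.1], y = [p.1.2] and
   t = [p.2]. The library norm on [R * R * R] is the max norm; it is used here
   only for derivatives of curves, where the choice of norm is irrelevant. *)
Definition norm2 (R : realType) (x y : R) : R := Num.sqrt (x ^+ 2 + y ^+ 2).

Definition euclid_dist (R : realType) (p q : R * R * R) : R :=
  Num.sqrt ((p.1.1 - q.1.1) ^+ 2 + (p.1.2 - q.1.2) ^+ 2 + (p.2 - q.2) ^+ 2).

Definition heis_mul (R : realType) (p q : R * R * R) : R * R * R :=
  (p.1.1 + q.1.1, p.1.2 + q.1.2,
   p.2 + q.2 - 2 * (p.1.1 * q.1.2 - p.1.2 * q.1.1)).

Definition heisX (R : realType) (p : R * R * R) : R * R * R :=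
  (1, 0, 2 * p.1.2).

Definition heisY (R : realType) (p : R * R * R) : R * R * R :=
  (0, 1, - (2 * p.1.1)).

(* [heisX] and [heisY] are the left-invariant fields of [heis_mul] that extend
   the first two coordinate directions at the origin. *)
Lemma heis_mul_X (R : realType) (p : R * R * R) (s : R) :
  heis_mul p (s, 0, 0) = p + s *: heisX p.
Proof.
case: p => -[x y] t; rewrite /heis_mul /heisX /=.
by congr (_, _, _) => /=; rewrite /GRing.scale /=; ring.
Qed.

Lemma heis_mul_Y (R : realType) (p : R * R * R) (s : R) :
  heis_mul p (0, s, 0) = p + s *: heisY p.
Proof.
case: p => -[x y] t; rewrite /heis_mul /heisY /=.
by congr (_, _, _) => /=; rewrite /GRing.scale /=; ring.
Qed.

Definition abs_continuous_curve (R : realType) (a b : R)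
    (gamma : R -> R * R * R) : Prop :=
  forall e : R, 0 < e -> exists2 delta : R, 0 < delta &
    forall (n : nat) (l r : 'I_n -> R),
      (forall i, a <= l i /\ l i <= r i /\ r i <= b) ->
      trivIset [set: 'I_n] (fun i => `]l i, r i[%classic) ->
      \sum_(i < n) (r i - l i) < delta ->
      \sum_(i < n) euclid_dist (gamma (l i)) (gamma (r i)) < e.

(* Values of [gamma] outside [a, b] are irrelevant: the derivative at [s] is
   constrained only for almost every [s] in [a, b]. *)
Definition horizontal (R : realType) (a b : R) (gamma : R -> R * R * R)
    (u1 u2 : R -> R) : Prop :=
  [/\ abs_continuous_curve a b gamma,
      (@lebesgue_measure R).-integrable `[a, b] (EFin \o u1),
      (@lebesgue_measure R).-integrable `[a, b] (EFin \o u2) &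
      {ae @lebesgue_measure R, forall s, `[a, b]%classic s ->
         is_derive s 1 gamma
           (u1 s *: heisX (gamma s) + u2 s *: heisY (gamma s))}].

Definition horizontal_length (R : realType) (a b : R) (u1 u2 : R -> R) : R :=
  (\int[@lebesgue_measure R]_(s in `[a, b]) norm2 (u1 s) (u2 s))%R.

Definition cc_lengths (R : realType) (p q : R * R * R) : set R :=
  [set L | exists (a b : R) (gamma : R -> R * R * R) (u1 u2 : R -> R),
     [/\ a < b, horizontal a b gamma u1 u2, gamma a = p, gamma b = q &
         L = horizontal_length a b u1 u2]].

(* [cc_lengths p q] is never empty (any two points are joined by a horizontal
   curve), so the convention [inf set0 = 0] plays no role. *)
Definition cc_dist (R : realType) (p q : R * R * R) : R :=
  inf (cc_lengths p q).

Definition affine_image (R : realType) (alpha beta : R) (S : set R) : set R :=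
  [set alpha + beta * s | s in S].

Fixpoint cantor_stage (R : realType) (n : nat) : set R :=
  if n is m.+1 then
    affine_image 0 3^-1 (@cantor_stage R m) `|`
    affine_image (2 / 3) 3^-1 (@cantor_stage R m)
  else `[0, 1]%classic.

Definition middle_third_cantor (R : realType) : set R :=
  \bigcap_n @cantor_stage R n.

Definition A_ (R : realType) (n k : nat) : set R :=
  affine_image (2 ^- n + k%:R * 2 ^- (2 * n)) (2 ^- (2 * n))
    (@middle_third_cantor R).

Definition Lambda (R : realType) : set (R * R * R) :=
  [set p | `|p.2| <= norm2 p.1.1 p.1.2].

Definition P_e (R : realType) : set (R * R * R) :=
  @Lambda R `&`
  ([set 0] `|`
   \bigcup_(n in [set n | (1 <= n)%N])
     \bigcup_(k in [set k | (k <= 2 ^ n - 1)%N])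
       [set p | @A_ R n k (norm2 p.1.1 p.1.2)]).

(* Main.v *)
Require Import Defs.
From mathcomp Require Import all_boot all_order all_algebra.
From mathcomp Require Import ring lra.
From mathcomp Require Import all_classical all_reals all_analysis measurable_realfun.

(** Euclidean porosity. At the origin the t-axis leaves the cone [|t| <= |z|]
at a definite angle, so balls centred on it at height [s] with radius [s / 3]
miss the set. At any other point only the radius [|z|] matters: moving along
the ray through [z] changes the radius by exactly the Euclidean distance
covered, and the radius is 1-Lipschitz. Porosity is therefore inherited from
the set of radii, where it is the self-similarity of the Cantor set: next to
each of its points, at every scale [3^-m], there is a hole of comparable size
([cantor_hole], [radii_porous]).

Non-porosity at the origin for the Carnot-Caratheodory distance. Let [p] have
distance [d] to the origin. Since the height has size at most [4 d^2]
([cc_dist_to_0]), the cone constraint is invisible at scale [d]: moving [p]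
outwards along its horizontal ray by about [lambda d / 4] puts it inside the
cone. This motion is horizontal and keeps the height fixed, so its cost is the
change of radius ([cc_dist_radial]). The radii near [s] have gaps at most [s^2]
([radii_dense]), again negligible against [lambda d], so one lands on a
point of the set within [lambda d] of [p] ([P_e_cc_near]), as soon as
[d < lambda / 16].

The quantitative input is the lower bound for the distance. A horizontal curve
of length [L] ending at the origin stays in [|x|, |y| <= L], and its height has
derivative at most [4 L |u|], whence [|t| <= 4 L^2] ([horizontal_to_0]).
Integrating these derivative bounds requires the fundamental theorem of
calculus for absolutely continuous functions, in the inequality form
[abs_cont_le_Rintegral]: it is obtained by chaining local estimates, which come
from differentiation outside a null set, and from absolute continuity on a
small open set that covers the null set. As [cc_dist] is an infimum, which is
[0] for an empty set of lengths, one also needs that every point can be joined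
to the origin; an explicit polynomial curve does it ([cc_lengths_to_0_neq0]). *)

Set Implicit Arguments.
Unset Strict Implicit.
Unset Printing Implicit Defensive.

Import Order.TTheory GRing.Theory Num.Theory.
Import numFieldNormedType.Exports.

Local Open Scope classical_set_scope.
Local Open Scope ring_scope.

(** * Euclidean norms of the plane and of the space *)

Lemma norm2_ge0 (R : realType) (x y : R) : 0 <= norm2 x y.
Proof. exact: sqrtr_ge0. Qed.

Lemma sqr_norm2 (R : realType) (x y : R) : norm2 x y ^+ 2 = x ^+ 2 + y ^+ 2.
Proof. by rewrite sqr_sqrtr// addr_ge0// sqr_ge0. Qed.

Lemma le_norm2l (R : realType) (x y : R) : `|x| <= norm2 x y.
Proof. by rewrite -sqrtr_sqr ler_wsqrtr// lerDl sqr_ge0. Qed.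

Lemma le_norm2r (R : realType) (x y : R) : `|y| <= norm2 x y.
Proof. by rewrite -sqrtr_sqr ler_wsqrtr// lerDr sqr_ge0. Qed.

Lemma norm2_le_add (R : realType) (x y : R) : norm2 x y <= `|x| + `|y|.
Proof.
rewrite -ler_sqr ?nnegrE ?norm2_ge0 ?addr_ge0// sqr_norm2.
rewrite -(real_normK (num_real x)) -(real_normK (num_real y)).
have := mulr_ge0 (normr_ge0 x) (normr_ge0 y); nra.
Qed.

Lemma norm2_scale (R : realType) (c x y : R) :
  norm2 (c * x) (c * y) = `|c| * norm2 x y.
Proof. by rewrite /norm2 !exprMn -mulrDr sqrtrM ?sqr_ge0// sqrtr_sqr. Qed.

(** The middle term is controlled by Cauchy-Schwarz, which is Lagrange's
identity with the square of [x * w - y * z] dropped. *)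
Lemma ler_norm2D (R : realType) (x y z w : R) :
  norm2 (x + z) (y + w) <= norm2 x y + norm2 z w.
Proof.
rewrite -ler_sqr ?nnegrE ?norm2_ge0 ?addr_ge0 ?norm2_ge0//.
rewrite sqrrD !sqr_norm2.
have cs : x * z + y * w <= norm2 x y * norm2 z w.
  apply: le_trans (ler_norm _) _.
  rewrite -ler_sqr ?nnegrE ?mulr_ge0 ?norm2_ge0//.
  rewrite real_normK ?num_real// exprMn !sqr_norm2.
  have := sqr_ge0 (x * w - y * z); nra.
rewrite -mulr_natr; lra.
Qed.

Lemma ler_dist_norm2 (R : realType) (x y z w : R) :
  `|norm2 x y - norm2 z w| <= norm2 (x - z) (y - w).
Proof.
have h1 := ler_norm2D (x - z) (y - w) z w.
have h2 := ler_norm2D (z - x) (w - y) x y.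
have h3 : norm2 (z - x) (w - y) = norm2 (x - z) (y - w).
  by rewrite /norm2 -opprB sqrrN -[w - y]opprB sqrrN.
rewrite !subrK h3 in h1 h2; rewrite ler_norml; apply/andP; split; lra.
Qed.

Lemma norm2_le_euclid_dist (R : realType) (p q : R * R * R) :
  norm2 (p.1.1 - q.1.1) (p.1.2 - q.1.2) <= euclid_dist p q.
Proof. by rewrite ler_wsqrtr// lerDl sqr_ge0. Qed.

Lemma height_le_euclid_dist (R : realType) (p q : R * R * R) :
  `|p.2 - q.2| <= euclid_dist p q.
Proof. by rewrite -sqrtr_sqr ler_wsqrtr// lerDr addr_ge0// sqr_ge0. Qed.

Lemma euclid_dist_le_add (R : realType) (p q : R * R * R) :
  euclid_dist p q <= `|p.1.1 - q.1.1| + `|p.1.2 - q.1.2| + `|p.2 - q.2|.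
Proof.
rewrite -[leLHS](_ : norm2 (norm2 (p.1.1 - q.1.1) (p.1.2 - q.1.2)) (p.2 - q.2) = _).
  apply: le_trans (norm2_le_add _ _) _; rewrite lerD2r ger0_norm ?norm2_ge0//.
  exact: norm2_le_add.
by rewrite {1}/norm2 sqr_norm2.
Qed.


Lemma norm2_eq0 (R : realType) (x y : R) : norm2 x y = 0 -> x = 0 /\ y = 0.
Proof.
move=> n0; have := le_norm2l x y; have := le_norm2r x y.
by rewrite n0 !normr_le0 => /eqP-> /eqP->.
Qed.

(** For the zero vector any direction is admissible; this spares a case
distinction when points are moved along the ray through them. *)
Lemma polar (R : realType) (x y : R) (r := norm2 x y) :
  exists e1 e2, [/\ norm2 e1 e2 = 1, x = r * e1 & y = r * e2].
Proof.
have [r0|rN0] := eqVneq r 0.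
  have [-> ->] := norm2_eq0 r0; exists 1, 0; rewrite r0 !mul0r; split=> //.
  by rewrite /norm2 expr1n expr0n /= addr0 sqrtr1.
exists (r^-1 * x), (r^-1 * y); rewrite !mulVKf//; split=> //.
by rewrite norm2_scale ger0_norm ?invr_ge0 ?norm2_ge0// mulVf.
Qed.

Lemma norm2_polar (R : realType) (r e1 e2 : R) :
  norm2 e1 e2 = 1 -> 0 <= r -> norm2 (r * e1) (r * e2) = r.
Proof. by move=> e r0; rewrite norm2_scale e mulr1 ger0_norm. Qed.

(** * Integrating derivative bounds of absolutely continuous functions *)

(** Cousin's covering principle: the supremum of the [x] with [Q a x] cannot
lie before [b], because locality at the supremum carries [Q] across it. *)
Lemma cousin (R : realType) (a b : R) (Q : R -> R -> Prop) : a <= b ->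
  (forall l m r, a <= l -> l <= m -> m <= r -> r <= b ->
    Q l m -> Q m r -> Q l r) ->
  (forall x, a <= x -> x <= b -> exists2 d, 0 < d &
    forall l r, a <= l -> l <= x -> x <= r -> r <= b ->
      x - d < l -> r < x + d -> Q l r) ->
  Q a b.
Proof.
move=> ab Qtrans Qloc.
pose S := [set x | a <= x /\ x <= b /\ Q a x].
have Sa : S a.
  have [d d0 dQ] := Qloc a (lexx a) ab.
  by split=> //; split=> //; apply: dQ; rewrite ?lexx//; lra.
have hS : has_sup S by split; [exists a | exists b => x [_ []]].
have ac : a <= sup S by exact: sup_upper_bound.
have cb : sup S <= b by apply: ge_sup => //; [exists a | move=> x [_ []]].
have [d d0 dQ] := Qloc _ ac cb.
have [x [ax [xb Qx]] cx] := sup_adherent d0 hS.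
have xc : x <= sup S by exact: sup_upper_bound.
(* [y] lies beyond [sup S] unless [sup S = b], and within its gauge. *)
pose y := Order.min b (sup S + d / 2).
have [cy yb yd] : [/\ sup S <= y, y <= b & y < sup S + d].
  rewrite /y; case: (leP b (sup S + d / 2)) => h; split; lra.
have Sy : S y.
  split; first lra.
  split=> //; apply: (Qtrans a x y) => //; first lra.
  by apply: dQ.
have := sup_upper_bound hS Sy.
move: Sy => [_ [_]]; rewrite {1 2}/y; case: (leP b (sup S + d / 2)) => h //.
by move=> _ h2; exfalso; lra.
Qed.

(** The scalar counterpart of [abs_continuous_curve]. *)
Definition abs_cont (R : realType) (a b : R) (f : R -> R) : Prop :=
  forall e : R, 0 < e -> exists2 delta : R, 0 < delta &
    forall (n : nat) (l r : 'I_n -> R),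
      (forall i, a <= l i /\ l i <= r i /\ r i <= b) ->
      trivIset [set: 'I_n] (fun i => `]l i, r i[%classic) ->
      \sum_(i < n) (r i - l i) < delta ->
      \sum_(i < n) `|f (r i) - f (l i)| < e.

Definition ord_cat (A : Type) m n (f : 'I_m -> A) (g : 'I_n -> A)
    (i : 'I_(m + n)) : A :=
  match fintype.split i with inl j => f j | inr j => g j end.

Lemma ord_cat_lshift (A : Type) m n (f : 'I_m -> A) (g : 'I_n -> A) i :
  ord_cat f g (lshift n i) = f i.
Proof. by rewrite /ord_cat (unsplitK (inl i)). Qed.

Lemma ord_cat_rshift (A : Type) m n (f : 'I_m -> A) (g : 'I_n -> A) i :
  ord_cat f g (rshift m i) = g i.
Proof. by rewrite /ord_cat (unsplitK (inr i)). Qed.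

Lemma trivIset_itv_cat (R : realType) (x : R) m n (l1 r1 : 'I_m -> R)
    (l2 r2 : 'I_n -> R) :
  (forall i, r1 i <= x) -> (forall i, x <= l2 i) ->
  trivIset [set: 'I_m] (fun i => `]l1 i, r1 i[%classic) ->
  trivIset [set: 'I_n] (fun i => `]l2 i, r2 i[%classic) ->
  trivIset [set: 'I_(m + n)] (fun i => `]ord_cat l1 l2 i, ord_cat r1 r2 i[%classic).
Proof.
move=> r1x xl2 T1 T2 i j _ _; rewrite /ord_cat.
rewrite -[i in _ -> i = _]splitK -[j in _ -> _ = j]splitK.
case: (fintype.split i) => i'; case: (fintype.split j) => j' /= -[z []] /=; rewrite !in_itv/=.
- by move=> zi zj; congr (lshift _ _); apply: T1 => //; exists z.
- move=> /andP[_ zi] /andP[zj _]; exfalso.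
  by have := r1x i'; have := xl2 j'; lra.
- move=> /andP[zi _] /andP[_ zj]; exfalso.
  by have := r1x j'; have := xl2 i'; lra.
- by move=> zi zj; congr (rshift _ _); apply: T2 => //; exists z.
Qed.

(** [G] is a candidate majorant of the increments of [f], and [H] a budget for
the length of the intervals where [G] fails to be one. By Cousin's principle the
interval splits into pieces of the two kinds; the pieces of the second kind form
a disjoint family of total length below [d], which is where absolute continuity
applies. The family is carried through the chaining, since the bound [e] holds
only for the sum over all of it. *)
Lemma abs_cont_increment_le (R : realType) (a b d e : R) (f G H : R -> R) :
  a <= b ->
  (forall (n : nat) (l r : 'I_n -> R),
      (forall i, a <= l i /\ l i <= r i /\ r i <= b) ->
      trivIset [set: 'I_n] (fun i => `]l i, r i[%classic) ->
      \sum_(i < n) (r i - l i) < d ->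
      \sum_(i < n) `|f (r i) - f (l i)| < e) ->
  (forall x y, a <= x -> x <= y -> y <= b -> G x <= G y) ->
  (forall x y, a <= x -> x <= y -> y <= b -> H x <= H y) ->
  H b - H a < d ->
  (forall x, a <= x -> x <= b -> exists2 eta, 0 < eta &
    forall l r, a <= l -> l <= x -> x <= r -> r <= b ->
      x - eta < l -> r < x + eta ->
      `|f r - f l| <= G r - G l \/ r - l <= H r - H l) ->
  `|f b - f a| <= G b - G a + e.
Proof.
move=> ab acf Gmono Hmono Hd loc.
suff [n [l [r [lr T lrH fle]]]] : exists (n : nat) (l r : 'I_n -> R),
    [/\ forall i, a <= l i /\ l i <= r i /\ r i <= b,
        trivIset [set: 'I_n] (fun i => `]l i, r i[%classic),
        \sum_(i < n) (r i - l i) <= H b - H a &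
        `|f b - f a| <= G b - G a + \sum_(i < n) `|f (r i) - f (l i)|].
  have := acf n l r lr T (le_lt_trans lrH Hd); lra.
apply: (@cousin _ a b (fun u v => exists (n : nat) (l r : 'I_n -> R),
    [/\ forall i, u <= l i /\ l i <= r i /\ r i <= v,
        trivIset [set: 'I_n] (fun i => `]l i, r i[%classic),
        \sum_(i < n) (r i - l i) <= H v - H u &
        `|f v - f u| <= G v - G u + \sum_(i < n) `|f (r i) - f (l i)|])) => //.
- move=> u v w au uv vw wb [m [l1 [r1 [lr1 T1 H1 f1]]]]
    [n [l2 [r2 [lr2 T2 H2 f2]]]].
  exists (m + n)%N, (ord_cat l1 l2), (ord_cat r1 r2); split.
  + move=> i; rewrite /ord_cat; case: (fintype.split i) => j.
      by have := lr1 j; lra.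
    by have := lr2 j; lra.
  + apply: (@trivIset_itv_cat _ v) => // i.
      by have := lr1 i; lra.
    by have := lr2 i; lra.
  + rewrite big_split_ord /=.
    under eq_bigr do rewrite !ord_cat_lshift.
    under [X in _ + X <= _]eq_bigr do rewrite !ord_cat_rshift.
    lra.
  + rewrite big_split_ord /=.
    under eq_bigr do rewrite !ord_cat_lshift.
    under [X in _ + (_ + X)]eq_bigr do rewrite !ord_cat_rshift.
    have := ler_normD (f w - f v) (f v - f u).
    have -> : f w - f v + (f v - f u) = f w - f u by ring.
    lra.
- move=> x ax xb; have [eta eta0 etaP] := loc x ax xb; exists eta => //.
  move=> l r al lx xr rb xl rx; have [fG|lrH] := etaP l r al lx xr rb xl rx.
    (* A piece of the first kind contributes nothing to the family. *)
    exists 0%N, (fun=> 0), (fun=> 0); split=> //; try by case.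
    + by rewrite big_ord0 subr_ge0; apply: Hmono => //; lra.
    + by rewrite big_ord0 addr0.
  exists 1%N, (fun=> l), (fun=> r); split=> //; try by case.
  + by move=> _; lra.
  + by move=> i j _ _ _; rewrite !ord1.
  + by rewrite big_ord1.
  + rewrite big_ord1 lerDr subr_ge0; apply: Gmono => //; lra.
Qed.

Lemma is_derive_quotient_near (R : realType) (f : R -> R) (s df e : R) :
  is_derive s 1 f df -> 0 < e -> exists2 eta, 0 < eta &
    forall y, `|y - s| < eta -> `|f y - f s - df * (y - s)| <= e * `|y - s|.
Proof.
move=> [df1 df2] e0.
have q : h^-1 *: ((f \o shift s) (h *: 1) - f s) @[h --> 0^'] --> df.
  by rewrite -df2.
have /cvgrPdist_lt/(_ _ e0) := q.
rewrite /dnbhs /within /= => /nbhs_ballP[eta /= eta0 etaP].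
exists eta => // y ys.
have [->|yNs] := eqVneq y s; first by rewrite !subrr mulr0 subr0 normr0 mulr0.
have ys0 : y - s != 0 by rewrite subr_eq0.
have := etaP (y - s); rewrite /ball /= sub0r normrN => /(_ ys ys0).
rewrite /GRing.scale /= mulr1 subrK => dq.
rewrite -ler_pdivrMr ?normr_gt0// -normfV -normrM.
apply/ltW; apply: le_lt_trans dq; rewrite -normrN.
rewrite le_eqVlt; apply/orP; left; apply/eqP; congr (`|_|).
by field.
Qed.

(** The slack [e] absorbs the error of both difference quotients, so that no
strict inequality between the derivatives is needed. *)
Lemma is_derive_dominated (R : realType) (f G : R -> R) (s df dG e : R) :
  is_derive s 1 f df -> is_derive s 1 G dG -> `|df| <= dG -> 0 < e ->
  exists2 eta, 0 < eta &
    forall y, `|y - s| < eta -> `|f y - f s| <= `|G y - G s| + e * `|y - s|.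
Proof.
move=> dfs dGs dfdG e0.
have e20 : 0 < e / 2 by lra.
have [e1 e10 e1P] := is_derive_quotient_near dfs e20.
have [e2 e20' e2P] := is_derive_quotient_near dGs e20.
exists (Order.min e1 e2); first by rewrite lt_min e10.
move=> y; rewrite lt_min => /andP[/e1P h1 /e2P h2].
have h3 := ler_normD (f y - f s - df * (y - s)) (df * (y - s)).
rewrite subrK in h3.
have h4 := ler_normD (G y - G s - dG * (y - s)) (- (G y - G s)).
rewrite normrN in h4.
have h5 : `|G y - G s - dG * (y - s) - (G y - G s)| = dG * `|y - s|.
  rewrite (_ : _ - (G y - G s) = - (dG * (y - s))); last by ring.
  by rewrite normrN normrM (ger0_norm (le_trans _ dfdG)).
rewrite h5 in h4; rewrite normrM in h3.
have h6 := ler_wpM2r (normr_ge0 (y - s)) dfdG.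
lra.
Qed.

(** The budget function of [abs_cont_increment_le]: [H x] is the measure of the
part of [O] to the left of [x]. *)
Lemma open_set_cdf (R : realType) (O : set R) (d : R) : open O ->
  (@lebesgue_measure R O < d%:E)%E ->
  exists H : R -> R, [/\ forall x y, x <= y -> H x <= H y,
    forall x y, H y - H x < d &
    forall l r, l <= r -> `[l, r]%classic `<=` O -> r - l <= H r - H l].
Proof.
move=> oO Od.
have mO : measurable O by exact: open_measurable.
have mI (x : R) : measurable (O `&` `]-oo, x]%classic) by exact: measurableI.
have leO x : (lebesgue_measure (O `&` `]-oo, x]%classic) <= @lebesgue_measure R O)%E.
  by apply: le_measure => //; rewrite ?inE//; exact: mI.
have fO x : lebesgue_measure (O `&` `]-oo, x]%classic) \is a fin_num.
  rewrite ge0_fin_numE//; apply: le_lt_trans (leO x) _.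
  by apply: lt_trans Od _; exact: ltry.
exists (fun x => fine (lebesgue_measure (O `&` `]-oo, x]%classic))); split.
- move=> x y xy; apply: fine_le => //; apply: le_measure; rewrite ?inE//.
  + exact: mI.
  + exact: mI.
  + move=> z /= []; rewrite !in_itv/= => ? zx; split=> //; exact: le_trans xy.
- move=> x y.
  have h1 : 0 <= fine (lebesgue_measure (O `&` `]-oo, x]%classic)) by exact: fine_ge0.
  have h2 : fine (lebesgue_measure (O `&` `]-oo, y]%classic)) < d.
    by rewrite -lte_fin fineK//; exact: le_lt_trans Od.
  lra.
- move=> l r lr lrO; rewrite -lee_fin EFinB EFinB !fineK//.
  rewrite leeBrDr//.
  rewrite [leRHS](_ : _ = lebesgue_measure ((O `&` `]-oo, l]%classic) `|` `]l, r]%classic)).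
    rewrite measureU//; [|exact: mI|].
    2: by apply/seteqP; split=> // z /= [[_]]; rewrite !in_itv/= => zl /andP[]; lra.
    rewrite [leRHS]addeC; apply: leeD; last exact: lexx.
    rewrite -[leRHS]/(lebesgue_measure `]l, r]%classic).
    rewrite lebesgue_measure_itv/= lte_fin; case: ifPn => // lr'.
    have -> : l = r by apply/eqP; rewrite eq_le lr leNgt.
    by rewrite -EFinB subrr.
  congr (lebesgue_measure _); apply/seteqP; split=> z /=; rewrite !in_itv/=.
    move=> [Oz zr]; have [zl|lz] := leP z l; first by left.
    by right; rewrite zr.
  move=> [[Oz zl]|/andP[lz zr]]; split=> //; first exact: le_trans lr.
  by apply: lrO; rewrite /= in_itv/= zr ltW.
Qed.

(** Lebesgue differentiation. The primitive starts at [a - 1], to the left of [a],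
so that the differentiation theorem also covers the endpoint [a]; the integrand is
cut off outside [[a, b]]. *)
Lemma Rintegral_primitive (R : realType) (a b : R) (h : R -> R) : a <= b ->
  (forall s, 0 <= h s) ->
  (@lebesgue_measure R).-integrable `[a, b] (EFin \o h) ->
  exists G : R -> R, [/\ forall x y, a <= x -> x <= y -> G x <= G y,
    G b - G a = (\int[@lebesgue_measure R]_(s in `[a, b]) h s)%R &
    {ae @lebesgue_measure R, forall s, `[a, b]%classic s ->
      is_derive s 1 G (h s)}].
Proof.
move=> ab h0 inth.
pose g := h \_ `[a, b]%classic.
have g0 s : 0 <= g s by rewrite /g patchE; case: ifP.
have intg : (@lebesgue_measure R).-integrable setT (EFin \o g).
  by move: inth; rewrite integrable_mkcond// restrict_EFin.
have intgI (i : interval R) : (@lebesgue_measure R).-integrable [set` i] (EFin \o g).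
  by apply: integrableS intg.
exists (fun x => \int[@lebesgue_measure R]_(t in `[a - 1, x]) g t)%R; split.
- move=> x y ax xy; rewrite -subr_ge0 Rintegral_itvB ?bnd_simp//; last by lra.
  exact: Rintegral_ge0.
- rewrite Rintegral_itvB ?bnd_simp//; last by lra.
  rewrite Rintegral_itv_obnd_cbnd//.
  by apply: eq_Rintegral => s sab; rewrite /g patchE sab.
- have locg : locally_integrable [set: R] g.
    by apply: open_integrable_locally => //; exact: openT.
  have := @FTC1 R g (BLeft (a - 1)) (fun y => intgI _) locg.
  apply: (@filterS _ _ (ae_filter_ringOfSetsType (@lebesgue_measure R))) => s /= sG sab.
  have [|dG1 dG2] := sG.
    by move: sab; rewrite /= in_itv/= lte_fin => /andP[? _]; lra.
  split=> //; rewrite -derive1E dG2 /g patchE mem_set//.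
Qed.

(** For [e > 0] the majorant is the primitive of [h] plus a small linear term. It
dominates the increments of [f] near every point where both derivatives exist;
the exceptional null set is put in an open set whose measure is below the
modulus of absolute continuity. *)
Lemma abs_cont_le_Rintegral (R : realType) (a b : R) (f h : R -> R) : a <= b ->
  abs_cont a b f -> (forall s, 0 <= h s) ->
  (@lebesgue_measure R).-integrable `[a, b] (EFin \o h) ->
  {ae @lebesgue_measure R, forall s, `[a, b]%classic s ->
    exists2 df, is_derive s 1 f df & `|df| <= h s} ->
  `|f b - f a| <= (\int[@lebesgue_measure R]_(s in `[a, b]) h s)%R.
Proof.
move=> ab acf h0 inth aef.
have [G0 [G0mono <- aeG]] := Rintegral_primitive ab h0 inth.
apply/ler_addgt0Pr => e e0.
(* The slope [k] costs at most [e / 2] over the interval, also when [a = b]. *)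
pose k := e / (2 * (b - a + 1)).
have k0 : 0 < k by rewrite divr_gt0//; lra.
have kb : k * (b - a) <= e / 2.
  have : k * (b - a + 1) = e / 2 by rewrite /k; field; lra.
  lra.
pose G x := G0 x + k * x.
have e20 : 0 < e / 2 by lra.
have [d d0 acfd] := acf _ e20.
have Gmono x y : a <= x -> x <= y -> y <= b -> G x <= G y.
  by move=> ax xy yb; rewrite lerD//; [exact: G0mono|rewrite ler_pM2l].
pose good s := `[a, b]%classic s ->
  (exists2 df, is_derive s 1 f df & `|df| <= h s) /\ is_derive s 1 G0 (h s).
have : (@lebesgue_measure R).-negligible (~` [set s | good s]).
  have := @filterI _ _ (ae_filter_ringOfSetsType (@lebesgue_measure R)) _ _ aef aeG.
  apply: (@filterS _ _ (ae_filter_ringOfSetsType (@lebesgue_measure R))) => s [] h1 h2 sab.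
  by split; [exact: h1|exact: h2].
move=> /negligible_outer_measure N0.
have d20 : 0 < d / 2 by lra.
have [U [oU NU]] := outer_measure_open_le (~` [set s | good s]) d20.
rewrite N0 add0e => Ud.
have [|H [Hmono Hd HU]] := @open_set_cdf R U d oU.
  by apply: le_lt_trans Ud _; rewrite lte_fin; lra.
have key : `|f b - f a| <= G b - G a + e / 2.
  apply: (@abs_cont_increment_le _ a b d (e / 2) f G H) => //.
    by move=> x y _ xy _; exact: Hmono.
  move=> x ax xb; have [Ux|NUx] := pselect (U x).
    have /nbhs_ballP[eta /= eta0 etaP] : nbhs x U by exact: open_nbhs_nbhs.
    exists eta => // l r al lx xr rb xl rx; right; apply: HU; first lra.
    move=> z /=; rewrite in_itv/= => /andP[lz zr]; apply: etaP.
    rewrite /ball/= ltr_norml; apply/andP; split; lra.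
  have gx : good x by apply: contrapT => Nx; apply: NUx; exact: NU.
  have [|[df dfx dfh] dGx] := gx; first by rewrite /= in_itv/= ax.
  have [eta eta0 etaP] := is_derive_dominated dfx dGx dfh k0.
  exists eta => // l r al lx xr rb xl rx; left.
  have [nl nr] : `|l - x| < eta /\ `|r - x| < eta.
    by rewrite !ltr_norml; split; apply/andP; split; lra.
  have := etaP _ nl; have := etaP _ nr.
  rewrite (ger0_norm (_ : 0 <= r - x)) ?subr_ge0//.
  rewrite (ger0_norm (_ : 0 <= G0 r - G0 x)) ?subr_ge0 ?G0mono//.
  rewrite (ler0_norm (_ : l - x <= 0)) ?subr_le0//.
  rewrite (ler0_norm (_ : G0 l - G0 x <= 0)) ?subr_le0 ?G0mono//.
  have := ler_normB (f r - f x) (f l - f x).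
  rewrite (_ : f r - f x - (f l - f x) = f r - f l); last by ring.
  rewrite /G; lra.
move: key; rewrite /G; lra.
Qed.

(** * Lower bounds for the length of horizontal curves *)

Lemma abs_cont_coord (R : realType) (a b : R) (gamma : R -> R * R * R)
    (phi : R * R * R -> R) :
  (forall p q, `|phi p - phi q| <= euclid_dist p q) ->
  abs_continuous_curve a b gamma -> abs_cont a b (phi \o gamma).
Proof.
move=> phi1 acg e e0; have [d d0 dP] := acg e e0; exists d => // n l r lr T lrd.
apply: le_lt_trans (dP n l r lr T lrd); apply: ler_sum => i _.
by rewrite distrC; exact: phi1.
Qed.

Lemma abs_cont_subitv (R : realType) (a a' b : R) (f : R -> R) :
  a <= a' -> abs_cont a b f -> abs_cont a' b f.
Proof.
move=> aa' acf e e0; have [d d0 dP] := acf e e0; exists d => // n l r lr.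
by apply: dP => i; have := lr i; lra.
Qed.

Lemma is_derive_fst (R : realType) (V W : normedModType R) (f : R -> V * W)
    (s : R) (df : V * W) :
  is_derive s 1 f df -> is_derive s 1 (fst \o f) df.1.
Proof.
move=> [df1 df2].
have q : h^-1 *: ((f \o shift s) (h *: 1) - f s) @[h --> 0^'] --> df.
  by rewrite -df2.
have q1 : h^-1 *: (((fst \o f) \o shift s) (h *: 1) - (fst \o f) s) @[h --> 0^'] --> df.1.
  have c : (@fst V W) x @[x --> df] --> df.1.
    by case: df {df2 q} => ? ?; exact: cvg_fst.
  exact: (cvg_comp _ _ q c).
by split; [apply/cvg_ex; exists df.1|exact: cvg_lim q1].
Qed.

Lemma is_derive_snd (R : realType) (V W : normedModType R) (f : R -> V * W)
    (s : R) (df : V * W) :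
  is_derive s 1 f df -> is_derive s 1 (snd \o f) df.2.
Proof.
move=> [df1 df2].
have q : h^-1 *: ((f \o shift s) (h *: 1) - f s) @[h --> 0^'] --> df.
  by rewrite -df2.
have q1 : h^-1 *: (((snd \o f) \o shift s) (h *: 1) - (snd \o f) s) @[h --> 0^'] --> df.2.
  have c : (@snd V W) x @[x --> df] --> df.2.
    by case: df {df2 q} => ? ?; exact: cvg_snd.
  exact: (cvg_comp _ _ q c).
by split; [apply/cvg_ex; exists df.2|exact: cvg_lim q1].
Qed.

Lemma is_derive_pair (R : realType) (V W : normedModType R) (f : R -> V)
    (g : R -> W) (s : R) (df : V) (dg : W) :
  is_derive s 1 f df -> is_derive s 1 g dg ->
  is_derive s 1 (fun x => (f x, g x)) (df, dg).
Proof.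
move=> [df1 df2] [dg1 dg2].
have qf : h^-1 *: ((f \o shift s) (h *: 1) - f s) @[h --> 0^'] --> df.
  by rewrite -df2.
have qg : h^-1 *: ((g \o shift s) (h *: 1) - g s) @[h --> 0^'] --> dg.
  by rewrite -dg2.
have q : h^-1 *: (((fun x => (f x, g x)) \o shift s) (h *: 1) - (f s, g s))
    @[h --> 0^'] --> (df, dg).
  exact: cvg_pair qf qg.
by split; [apply/cvg_ex; exists (df, dg)|exact: cvg_lim q].
Qed.

Lemma measurable_norm2 (R : realType) (D : set R) (u1 u2 : R -> R) :
  measurable D -> measurable_fun D u1 -> measurable_fun D u2 ->
  measurable_fun D (fun s => norm2 (u1 s) (u2 s)).
Proof.
move=> mD m1 m2.
apply: (@measurableT_comp _ _ _ _ _ _ (@Num.sqrt R)).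
  by apply: continuous_measurable_fun; exact: sqrt_continuous.
by apply: measurable_funD; exact: measurable_funX.
Qed.

Lemma integrable_norm2 (R : realType) (D : set R) (u1 u2 : R -> R) :
  measurable D ->
  (@lebesgue_measure R).-integrable D (EFin \o u1) ->
  (@lebesgue_measure R).-integrable D (EFin \o u2) ->
  (@lebesgue_measure R).-integrable D (EFin \o (fun s => norm2 (u1 s) (u2 s))).
Proof.
move=> mD i1 i2.
have m1 : measurable_fun D u1 by apply/measurable_EFinP; exact: measurable_int i1.
have m2 : measurable_fun D u2 by apply/measurable_EFinP; exact: measurable_int i2.
have i12 : (@lebesgue_measure R).-integrable D
    (fun s => `|(EFin \o u1) s| + `|(EFin \o u2) s|)%E.
  by apply: integrableD => //; exact: integrable_abse.
refine (@le_integrable _ _ _ (@lebesgue_measure R) D mD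
  (EFin \o (fun s => norm2 (u1 s) (u2 s))) _ _ _ i12).
- by apply/measurable_EFinP; exact: measurable_norm2.
- move=> s _ /=; rewrite lee_fin ger0_norm ?norm2_ge0// ger0_norm ?addr_ge0//.
  exact: norm2_le_add.
Qed.

Lemma horizontal_derivE (R : realType) (p : R * R * R) (v1 v2 : R) :
  v1 *: heisX p + v2 *: heisY p =
  (v1, v2, 2 * (p.1.2 * v1 - p.1.1 * v2)).
Proof.
by congr (_, _, _); rewrite /= /GRing.scale /=; ring.
Qed.

(** The common core of the coordinate and height estimates. The left end [x] is
free because the height estimate needs the coordinate bounds along the whole
curve. *)
Lemma horizontal_coord_le (R : realType) (a b x c : R)
    (gamma : R -> R * R * R) (u1 u2 : R -> R) (phi : R * R * R -> R) :
  a <= x -> x <= b -> horizontal a b gamma u1 u2 -> 0 <= c ->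
  (forall p q, `|phi p - phi q| <= euclid_dist p q) ->
  (forall s, x <= s -> s <= b ->
    is_derive s 1 gamma (u1 s *: heisX (gamma s) + u2 s *: heisY (gamma s)) ->
    exists2 df, is_derive s 1 (phi \o gamma) df &
                `|df| <= c * norm2 (u1 s) (u2 s)) ->
  `|phi (gamma b) - phi (gamma x)| <= c * horizontal_length a b u1 u2.
Proof.
move=> ax xb [acg i1 i2 aeg] c0 phi1 dphi.
have ab : a <= b by exact: le_trans xb.
have iN : (@lebesgue_measure R).-integrable `[a, b] (EFin \o (fun s => norm2 (u1 s) (u2 s))).
  exact: integrable_norm2.
have xbab : `[x, b]%classic `<=` `[a, b]%classic.
  by move=> z /=; rewrite !in_itv/= => /andP[xz ->]; rewrite (le_trans ax).
have iNx : (@lebesgue_measure R).-integrable `[x, b] (EFin \o (fun s => norm2 (u1 s) (u2 s))).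
  by apply: integrableS iN.
have := @abs_cont_le_Rintegral R x b (phi \o gamma) (fun s => c * norm2 (u1 s) (u2 s)) xb.
have -> : (\int[@lebesgue_measure R]_(s in `[x, b]) (c * norm2 (u1 s) (u2 s)) =
    c * \int[@lebesgue_measure R]_(s in `[x, b]) norm2 (u1 s) (u2 s))%R.
  exact: RintegralZl.
move=> H; apply: le_trans (H _ _ _ _) _.
- by apply: abs_cont_subitv ax _; exact: abs_cont_coord.
- by move=> s; rewrite mulr_ge0// norm2_ge0.
- have := @integrableZl _ _ _ (@lebesgue_measure R) `[x, b]%classic (measurable_itv _) c _ iNx.
  by [].
- apply: (@filterS _ _ (ae_filter_ringOfSetsType (@lebesgue_measure R))) aeg.
  move=> s ds sxb; move: (sxb); rewrite /= in_itv/= => /andP[xs sb].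
  by apply: dphi => //; apply: ds; exact: xbab.
- rewrite ler_wpM2l//.
  rewrite /horizontal_length /Rintegral fine_le//.
  + exact: integrable_fin_num.
  + exact: integrable_fin_num.
  + apply: ge0_subset_integral => //.
    * exact: measurable_int iN.
    * by move=> s _; rewrite lee_fin norm2_ge0.
Qed.

(** The coordinates are bounded by [L] along the whole curve, hence
[|t'| = 2 |y u1 - x u2| <= 4 L |u|], which integrates to [4 L^2]. *)
Lemma horizontal_to_0 (R : realType) (a b : R) (gamma : R -> R * R * R)
    (u1 u2 : R -> R) (L := horizontal_length a b u1 u2) :
  a < b -> horizontal a b gamma u1 u2 -> gamma b = 0 ->
  [/\ `|(gamma a).1.1| <= L, `|(gamma a).1.2| <= L & `|(gamma a).2| <= 4 * L ^+ 2].
Proof.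
move=> ab hg gb0.
have xL x : a <= x -> x <= b -> `|(gamma x).1.1| <= L.
  move=> ax xb; have := @horizontal_coord_le R a b x 1 gamma u1 u2 (fun p => p.1.1) ax xb hg ler01.
  rewrite gb0 /= sub0r normrN mul1r; apply.
    by move=> p q; apply: le_trans (norm2_le_euclid_dist _ _); exact: le_norm2l.
  move=> s _ _ ds; exists (u1 s); last by rewrite mul1r le_norm2l.
  by move: ds; rewrite horizontal_derivE => /is_derive_fst/is_derive_fst.
have yL x : a <= x -> x <= b -> `|(gamma x).1.2| <= L.
  move=> ax xb; have := @horizontal_coord_le R a b x 1 gamma u1 u2 (fun p => p.1.2) ax xb hg ler01.
  rewrite gb0 /= sub0r normrN mul1r; apply.
    by move=> p q; apply: le_trans (norm2_le_euclid_dist _ _); exact: le_norm2r.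
  move=> s _ _ ds; exists (u2 s); last by rewrite mul1r le_norm2r.
  by move: ds; rewrite horizontal_derivE => /is_derive_fst/is_derive_snd.
split; [exact: (xL _ (lexx _) (ltW ab))|exact: (yL _ (lexx _) (ltW ab))|].
have L0 : 0 <= L by exact: le_trans (xL _ (lexx _) (ltW ab)).
have := @horizontal_coord_le R a b a (4 * L) gamma u1 u2 (fun p => p.2) (lexx _) (ltW ab) hg.
rewrite gb0 /= sub0r normrN -mulrA -expr2; apply; first by rewrite mulr_ge0.
  by move=> p q; exact: height_le_euclid_dist.
move=> s sa sb ds; exists (2 * ((gamma s).1.2 * u1 s - (gamma s).1.1 * u2 s)).
  by move: ds; rewrite horizontal_derivE => /is_derive_snd.
rewrite normrM ger0_norm//.
have h := ler_normB ((gamma s).1.2 * u1 s) ((gamma s).1.1 * u2 s).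
rewrite !normrM in h.
have h1 := ler_pM (normr_ge0 _) (normr_ge0 _) (yL s sa sb) (le_norm2l (u1 s) (u2 s)).
have h2 := ler_pM (normr_ge0 _) (normr_ge0 _) (xL s sa sb) (le_norm2r (u1 s) (u2 s)).
lra.
Qed.

(** * Polynomial horizontal curves and the Carnot-Caratheodory distance *)

Lemma poly_lipschitz (R : realType) (p : {poly R}) (a b : R) :
  exists2 K, 0 <= K & forall x y, a <= x -> x <= y -> y <= b ->
    `|p.[y] - p.[x]| <= K * (y - x).
Proof.
have [K Kp] := poly_itv_bound p^`() a b.
exists `|K|; first exact: normr_ge0.
move=> x y ax xy yb.
have [|c cxy ->] := @MVT_segment R (horner p) (horner p^`()) x y xy (fun z _ => is_derive_poly p z).
  by apply: continuous_subspaceT; exact: continuous_horner.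
rewrite normrM (ger0_norm (_ : 0 <= y - x)) ?subr_ge0// ler_wpM2r ?subr_ge0//.
apply: le_trans (ler_norm K); apply: Kp.
by move: cxy; rewrite in_itv/= => /andP[xc cy]; rewrite (le_trans ax)// (le_trans cy).
Qed.

Lemma abs_continuous_poly (R : realType) (p q r : {poly R}) (a b : R) :
  abs_continuous_curve a b (fun s => (p.[s], q.[s], r.[s])).
Proof.
have [K1 K10 h1] := poly_lipschitz p a b.
have [K2 K20 h2] := poly_lipschitz q a b.
have [K3 K30 h3] := poly_lipschitz r a b.
pose K := K1 + K2 + K3 + 1.
have K0 : 0 < K by rewrite /K; lra.
move=> e e0; exists (e / K); first by rewrite divr_gt0.
move=> n l u lu _; rewrite ltr_pdivlMr// mulrC mulr_sumr => lt_e.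
apply: le_lt_trans lt_e; apply: ler_sum => i _.
have [al [li ub]] := lu i.
apply: le_trans (euclid_dist_le_add _ _) _ => /=.
have e1 := h1 _ _ al li ub; have e2 := h2 _ _ al li ub; have e3 := h3 _ _ al li ub.
rewrite (distrC p.[l i]) (distrC q.[l i]) (distrC r.[l i]) /K.
have : 0 <= u i - l i by rewrite subr_ge0.
nra.
Qed.

Lemma horizontal_poly (R : realType) (p q r : {poly R}) (a b : R) :
  (forall s, r^`().[s] = 2 * (q.[s] * p^`().[s] - p.[s] * q^`().[s])) ->
  horizontal a b (fun s => (p.[s], q.[s], r.[s]))
    (horner p^`()) (horner q^`()).
Proof.
move=> rE.
have ip (h : {poly R}) : (@lebesgue_measure R).-integrable `[a, b] (EFin \o horner h).
  apply: continuous_compact_integrable; first exact: segment_compact.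
  by apply: continuous_subspaceT; exact: continuous_horner.
split=> //; first exact: abs_continuous_poly.
apply: aeW => s _; rewrite horizontal_derivE /= -rE.
exact: (is_derive_pair (is_derive_pair _ _) _).
Qed.

(** A planar curve [z = (1 - s) f(s)] ends at the origin, and its lift satisfies
[t' = - 2 (1 - s)^2 (f x f')], where [x] is the planar cross product. For
[f = z0 + s (c, 0) + s^2 (0, k)] the total change of height is
[- 2 (k (x / 6 + c / 30) - y c / 3)]. Choosing [c = 30 - 5 x] turns the coefficient
of [k] into [1], so [k] can be solved for to reach height [0]. *)
Lemma cc_lengths_to_0_neq0 (R : realType) (p : R * R * R) : cc_lengths p 0 !=set0.
Proof.
case: p => -[x y] t.
pose c := 30 - 5 * x; pose k := t / 2 + y * c / 3.
pose P : {poly R} := (1 - 'X) * (x%:P + c%:P * 'X).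
pose Q : {poly R} := (1 - 'X) * (y%:P + k%:P * 'X ^+ 2).
pose T : {poly R} := t%:P - 2%:P * (
    - (y * c)%:P * ('X - 'X ^+ 2 + (3^-1)%:P * 'X ^+ 3)
    + (2 * x * k)%:P * ((2^-1)%:P * 'X ^+ 2 - (2 / 3)%:P * 'X ^+ 3 + (4^-1)%:P * 'X ^+ 4)
    + (c * k)%:P * ((3^-1)%:P * 'X ^+ 3 - (2^-1)%:P * 'X ^+ 4 + (5^-1)%:P * 'X ^+ 5)).
exists (horizontal_length 0 1 (horner P^`()) (horner Q^`())).
exists 0, 1, (fun s => (P.[s], Q.[s], T.[s])), (horner P^`()), (horner Q^`()).
split=> //.
- apply: horizontal_poly => s; rewrite /P /Q /T !poly.derivE !hornerE /=.
  by field.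
- by rewrite /P /Q /T !hornerE /=; congr (_, _, _); ring.
- rewrite /P /Q /T !hornerE /=; congr (_, _, _); rewrite /k /c; by field.
Qed.

Lemma cc_lengths_ge0 (R : realType) (p q : R * R * R) (L : R) :
  cc_lengths p q L -> 0 <= L.
Proof.
move=> [a [b [g [u1 [u2 [_ _ _ _ ->]]]]]].
by apply: Rintegral_ge0 => s _; exact: norm2_ge0.
Qed.

(** These bounds hold for each admissible length, hence for the infimum; for the
quadratic one, it is the inequality [sqrt |t| / 2 <= L] that passes to the infimum. *)
Lemma cc_dist_to_0 (R : realType) (p : R * R * R) :
  [/\ `|p.1.1| <= cc_dist p 0, `|p.1.2| <= cc_dist p 0 &
      `|p.2| <= 4 * cc_dist p 0 ^+ 2].
Proof.
have ne := cc_lengths_to_0_neq0 p.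
have lb L : cc_lengths p 0 L ->
    [/\ `|p.1.1| <= L, `|p.1.2| <= L & `|p.2| <= 4 * L ^+ 2].
  move=> [a [b [g [u1 [u2 [ab hg <- gb ->]]]]]]; exact: horizontal_to_0.
split.
- by apply: lb_le_inf => // L /lb[].
- by apply: lb_le_inf => // L /lb[].
have d0 : 0 <= cc_dist p 0 by apply: lb_le_inf => // L /cc_lengths_ge0.
have : Num.sqrt `|p.2| / 2 <= cc_dist p 0.
  apply: lb_le_inf => // L cL; have [_ _ h] := lb L cL.
  have L0 := cc_lengths_ge0 cL.
  have : Num.sqrt `|p.2| <= Num.sqrt ((2 * L) ^+ 2).
    apply: ler_wsqrtr; apply: le_trans h _.
    by rewrite (_ : (2 * L) ^+ 2 = 4 * L ^+ 2)//; ring.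
  by rewrite sqrtr_sqr (ger0_norm (_ : 0 <= 2 * L)) ?mulr_ge0//; lra.
move=> h; rewrite -[`|p.2|]sqr_sqrtr//.
have := sqrtr_ge0 `|p.2|; nra.
Qed.

(** Along a ray through the axis the form [2 (y dx - x dy)] vanishes, so the
radial segment at constant height is horizontal. *)
Lemma cc_dist_radial (R : realType) (e1 e2 r1 r2 t : R) : norm2 e1 e2 = 1 ->
  cc_dist (r1 * e1, r1 * e2, t) (r2 * e1, r2 * e2, t) <= `|r2 - r1|.
Proof.
move=> ne.
apply: ge_inf; first by exists 0 => L /cc_lengths_ge0.
pose P : {poly R} := (r1 * e1)%:P + ((r2 - r1) * e1)%:P * 'X.
pose Q : {poly R} := (r1 * e2)%:P + ((r2 - r1) * e2)%:P * 'X.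
exists 0, 1, (fun s => (P.[s], Q.[s], (t%:P : {poly R}).[s])),
  (horner P^`()), (horner Q^`()).
split=> //.
- apply: horizontal_poly => s; rewrite /P /Q !poly.derivE !hornerE /=; ring.
- by rewrite /P /Q !hornerE.
- by rewrite /P /Q !hornerE /=; congr (_, _, _); ring.
- rewrite /horizontal_length.
  under eq_Rintegral do rewrite /P /Q !poly.derivE !hornerE norm2_scale ne mulr1.
  rewrite Rintegral_cst// -[X in fine X]/(@lebesgue_measure R `[0, 1]%classic).
  rewrite lebesgue_measure_itv/= lte_fin ltr01 /= .
  by rewrite subr0 mulr1.
Qed.

(** * The Cantor set and the set of radii *)

Lemma cantor_stage_itv (R : realType) n (c : R) :
  @cantor_stage R n c -> 0 <= c <= 1.
Proof.
elim: n c => [c|n IHn c]; first by rewrite /= in_itv.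
by case=> -[s /IHn/andP[s0 s1] <-]; apply/andP; split; lra.
Qed.

Lemma cantor_itv (R : realType) (c : R) : @middle_third_cantor R c -> 0 <= c <= 1.
Proof. by move=> Cc; exact: cantor_stage_itv (Cc 0%N I). Qed.

Lemma cantor1 (R : realType) : @middle_third_cantor R 1.
Proof.
move=> n _; elim: n => [|n IHn]; first by rewrite /= in_itv /= ler01 lexx.
by right; exists 1 => //; lra.
Qed.

(** Self-similarity: below the second third, a point of the Cantor set can only come
from the left copy at every stage. *)
Lemma cantor_left (R : realType) (c : R) :
  @middle_third_cantor R c -> c < 2 / 3 -> @middle_third_cantor R (3 * c).
Proof.
move=> Cc c23 n _; have [[s Cs <-]|[s Cs cE]] := Cc n.+1 I.
  by have -> : 3 * (0 + 3^-1 * s) = s by lra.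
by have /andP[s0 _] := cantor_stage_itv Cs; exfalso; lra.
Qed.

Lemma cantor_right (R : realType) (c : R) :
  @middle_third_cantor R c -> 1 / 3 < c -> @middle_third_cantor R (3 * c - 2).
Proof.
move=> Cc c13 n _; have [[s Cs cE]|[s Cs <-]] := Cc n.+1 I.
  by have /andP[_ s1] := cantor_stage_itv Cs; exfalso; lra.
by have -> : 3 * (2 / 3 + 3^-1 * s) - 2 = s by lra.
Qed.

Lemma cantor_gap (R : realType) (c : R) :
  @middle_third_cantor R c -> c <= 1 / 3 \/ 2 / 3 <= c.
Proof.
move=> Cc; have [[s Cs cE]|[s Cs cE]] := Cc 1%N I.
  by have /andP[_ s1] := @cantor_stage_itv R 0 s Cs; left; lra.
by have /andP[s0 _] := @cantor_stage_itv R 0 s Cs; right; lra.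
Qed.

(** For [m = 0] the hole is the middle third. A hole at scale [m + 1] is the
image of one at scale [m] under the contraction onto the copy that contains
[c]; keeping holes inside [(0, 1)] prevents them from meeting the other copy. *)
Lemma cantor_hole (R : realType) (c : R) m : @middle_third_cantor R c ->
  exists2 h, `|h - c| <= 3 ^- m / 2 &
    forall z, `|z - h| < 3 ^- m / 6 -> 0 < z < 1 /\ ~ @middle_third_cantor R z.
Proof.
elim: m c => [|m IHm] c Cc.
  have /andP[c0 c1] := cantor_itv Cc.
  exists (1 / 2); rewrite expr0 invr1; first by rewrite ler_norml; apply/andP; split; lra.
  move=> z; rewrite ltr_norml => /andP[z1 z2]; split; first by apply/andP; split; lra.
  by move=> /cantor_gap; lra.
have e3 : 3 ^- m.+1 = 3^-1 * 3 ^- m :> R by rewrite exprS invfM.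
have p3 : 0 < 3 ^- m :> R by rewrite invr_gt0 exprn_gt0.
have [c3|c3] := cantor_gap Cc.
  have [h hc hP] := IHm _ (cantor_left Cc (ltac:(lra) : c < 2 / 3)).
  exists (h / 3).
    by move: hc; rewrite e3 !ler_norml => /andP[? ?]; apply/andP; split; lra.
  move=> z zh; have [|/andP[z0 z1] NC] := hP (3 * z).
    by move: zh; rewrite e3 !ltr_norml => /andP[? ?]; apply/andP; split; lra.
  split; first by apply/andP; split; lra.
  by move=> Cz; apply: NC; apply: cantor_left => //; lra.
have [h hc hP] := IHm _ (cantor_right Cc (ltac:(lra) : 1 / 3 < c)).
exists (2 / 3 + h / 3).
  by move: hc; rewrite e3 !ler_norml => /andP[? ?]; apply/andP; split; lra.
move=> z zh; have [|/andP[z0 z1] NC] := hP (3 * z - 2).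
  by move: zh; rewrite e3 !ltr_norml => /andP[? ?]; apply/andP; split; lra.
split; first by apply/andP; split; lra.
by move=> Cz; apply: NC; apply: cantor_right => //; lra.
Qed.

Definition radii (R : realType) : set R :=
  \bigcup_(n in [set n | (1 <= n)%N])
     \bigcup_(k in [set k | (k <= 2 ^ n - 1)%N]) @A_ R n k.

Lemma P_eE (R : realType) (p : R * R * R) :
  @P_e R p <-> `|p.2| <= norm2 p.1.1 p.1.2 /\
    (p = 0 \/ @radii R (norm2 p.1.1 p.1.2)).
Proof.
by split=> -[Lp [p0|[n n1 [k kn A]]]]; split=> //; try (by left);
  right; exists n => //; exists k.
Qed.

Lemma cell_itv (R : realType) n k (q := 2 ^- (2 * n) : R) : (k <= 2 ^ n - 1)%N ->
  [/\ 0 < q, 0 < 2 ^- n :> R & 2 ^- n + (k%:R + 1) * q <= 2 * 2 ^- n].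
Proof.
move=> kn.
have p0 : 0 < 2 ^- n :> R by rewrite invr_gt0 exprn_gt0.
have qE : q = 2 ^- n * 2 ^- n by rewrite /q mul2n -addnn exprD invfM.
have kR : (k%:R + 1) * 2 ^- n <= 1 :> R.
  rewrite ler_pdivrMr ?exprn_gt0// mul1r natr1 -natrX ler_nat.
  by rewrite -[X in (_ <= X)%N](@subnK 1) ?expn_gt0// addn1 ltnS.
split=> //; first by rewrite qE mulr_gt0.
rewrite qE mulrA; have := ler_wpM2r (ltW p0) kR; lra.
Qed.

(** The closed cells that carry the sets [A_ n k] do not overlap: those of level
[n] lie in [[2^-n, 2^(1-n)]]. Hence a hole of the Cantor set placed in the
interior of a cell is not refilled by another cell. *)
Lemma cell_inj (R : realType) n k n' k' (s : R) :
  (k <= 2 ^ n - 1)%N -> (k' <= 2 ^ n' - 1)%N ->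
  2 ^- n + k%:R * 2 ^- (2 * n) < s < 2 ^- n + (k%:R + 1) * 2 ^- (2 * n) ->
  2 ^- n' + k'%:R * 2 ^- (2 * n') <= s <= 2 ^- n' + (k'%:R + 1) * 2 ^- (2 * n') ->
  n = n' /\ k = k'.
Proof.
move=> kn kn' /andP[s1 s2] /andP[s3 s4].
have [q0 p0 b] := cell_itv R kn; have [q0' p0' b'] := cell_itv R kn'.
have kq : 0 <= k%:R * 2 ^- (2 * n) :> R by rewrite mulr_ge0// ltW.
have kq' : 0 <= k'%:R * 2 ^- (2 * n') :> R by rewrite mulr_ge0// ltW.
have two m m' : (m < m')%N -> 2 * 2 ^- m' <= 2 ^- m :> R.
  move=> mm'; rewrite ler_pdivrMr ?exprn_gt0// mulrC ler_pdivlMr ?exprn_gt0//.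
  by rewrite -exprS ler_weXn2l// ler1n.
have nn' : n = n'.
  case: (ltngtP n n') => // /two h; exfalso; lra.
subst n'; split=> //.
have kk (i j : nat) : (i < j)%N -> (i%:R + 1) * 2 ^- (2 * n) <= j%:R * 2 ^- (2 * n) :> R.
  by move=> ij; rewrite ler_pM2r// natr1 ler_nat.
case: (ltngtP k k') => // /kk h; exfalso; lra.
Qed.

Lemma A_itv (R : realType) n k (s : R) : @A_ R n k s ->
  2 ^- n + k%:R * 2 ^- (2 * n) <= s <= 2 ^- n + (k%:R + 1) * 2 ^- (2 * n).
Proof.
move=> [c /cantor_itv/andP[c0 c1] <-].
have q0 : 0 < 2 ^- (2 * n) :> R by rewrite invr_gt0 exprn_gt0.
by apply/andP; split; nra.
Qed.

(** A hole of the Cantor set at scale [m] is at distance at most [3^-m / 2] and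
has radius [3^-m / 6]; the ratio is the porosity constant [1/3]. *)
Lemma radii_porous (R : realType) (r e : R) : @radii R r -> 0 < e ->
  exists rho, [/\ 0 < `|rho - r|, `|rho - r| < e &
    forall z, `|z - rho| < 3^-1 * `|rho - r| -> 0 < z /\ ~ @radii R z].
Proof.
move=> [n n1 [k kn [c Cc rE]]] e0.
have [q0 p0 b] := cell_itv R kn.
have kq : 0 <= k%:R * 2 ^- (2 * n) :> R by rewrite mulr_ge0// ltW.
have q1 : 2 ^- (2 * n) <= 1 :> R by rewrite invf_le1 ?exprn_gt0// exprn_ege1// ler1n.
move: rE q0 kq q1 b; rewrite /= -/(2 ^- (2 * n)).
set q := 2 ^- (2 * n); set al := 2 ^- n + k%:R * q => rE q0 kq q1 b.
have [m me] : exists m, 3 ^- m < e :> R.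
  exists (Num.bound e^-1); rewrite -[ltRHS]invrK ltf_pV2 ?posrE ?exprn_gt0 ?invr_gt0//.
  apply: lt_le_trans (archi_boundP _) _; first by rewrite invr_ge0 ltW.
  by rewrite -natrX ler_nat; exact: ltnW (ltn_expl _ _).
have p3 : 0 < 3 ^- m :> R by rewrite invr_gt0 exprn_gt0.
have [h hc hP] := cantor_hole m Cc.
have hNc : 0 < `|h - c|.
  rewrite normr_gt0 subr_eq0; apply/eqP => hcE.
  have [|_] := hP c; last by [].
  by rewrite hcE subrr normr0; lra.
have rr : `|al + q * h - r| = q * `|h - c|.
  rewrite (_ : al + q * h - r = q * (h - c)); last by rewrite -rE; ring.
  by rewrite normrM gtr0_norm.
exists (al + q * h); rewrite rr; split.
- by rewrite mulr_gt0.
- nra.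
- move=> z zh; pose w := (z - al) / q.
  have zE : z = al + q * w by rewrite /w; field; lra.
  have [|/andP[w0 w1] NC] := hP w.
    have : q * `|w - h| < q * (3 ^- m / 6).
      have -> : q * `|w - h| = `|z - (al + q * h)|.
        rewrite (_ : z - (al + q * h) = q * (w - h)); last by rewrite zE; ring.
        by rewrite normrM gtr0_norm.
      apply: lt_le_trans zh _; rewrite mulrCA ler_pM2l//; lra.
    by rewrite ltr_pM2l.
  split; first by rewrite zE /al; nra.
  move=> [n' _ [k' kn' A]].
  have [] := @cell_inj R n k n' k' z kn kn' _ (A_itv A).
    by rewrite -/q zE /al; apply/andP; split; nra.
  move=> nE kE; subst n' k'; apply: NC; case: A => c' Cc' /=.
  rewrite -/q -/al => c'E; have -> : w = c' by rewrite /w -c'E; field; lra.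
  by [].
Qed.

(** With [2^-n <= s < 2^(1-n)] the cells around [s] have length
[2^-2n <= s^2]. The right endpoint of the cell that contains [s] is taken, so
that no separate case arises for the last cell of a level. *)
Lemma radii_dense (R : realType) (s : R) : 0 < s -> s < 1 ->
  exists2 r, @radii R r & s < r <= s + s ^+ 2.
Proof.
move=> s0 s1.
have ex : exists n, 2 ^- n <= s :> R.
  exists (Num.bound s^-1); rewrite -[leRHS]invrK lef_pV2 ?posrE ?exprn_gt0 ?invr_gt0//.
  apply/ltW; apply: lt_le_trans (archi_boundP _) _; first by rewrite invr_ge0 ltW.
  by rewrite -natrX ler_nat; exact: ltnW (ltn_expl _ _).
case: (ex_minnP ex) => n ns nmin.
have n1 : (1 <= n)%N.
  by case: n ns {nmin} => // ; rewrite expr0 invr1; lra.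
have sn : s < 2 * 2 ^- n.
  rewrite ltNge; apply/negP => h.
  have e : 2 * 2 ^- n = 2 ^- n.-1 :> R.
    by rewrite -{1}(prednK n1) exprS invfM mulrA divff// mul1r.
  by have := nmin n.-1; rewrite -e => /(_ h); rewrite -ltnS prednK// ltnn.
have p0 : 0 < 2 ^- n :> R by rewrite invr_gt0 exprn_gt0.
have qE : 2 ^- (2 * n) = 2 ^- n * 2 ^- n :> R by rewrite mul2n -addnn exprD invfM.
have q0 : 0 < 2 ^- (2 * n) :> R by rewrite qE mulr_gt0.
pose u := (s - 2 ^- n) / 2 ^- (2 * n).
have u0 : 0 <= u by rewrite divr_ge0 ?subr_ge0// ltW.
have /andP[k1 k2] := truncn_itv u0.
set k := Num.truncn u in k1 k2.
have uE : s = 2 ^- n + u * 2 ^- (2 * n) by rewrite /u divfK ?gt_eqF// addrC subrK.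
have kn : (k <= 2 ^ n - 1)%N.
  rewrite subn1 -ltnS prednK ?expn_gt0// -(@ltr_nat R) natrX.
  apply: le_lt_trans k1 _; rewrite /u ltr_pdivrMr// qE mulrA divff ?expf_neq0// mul1r; lra.
exists (2 ^- n + k.+1%:R * 2 ^- (2 * n)).
  exists n => //; exists k => //; exists 1; first exact: cantor1.
  by rewrite -natr1; ring.
rewrite uE ltrD2l ltr_pM2r// k2 /= -uE -natr1.
have : k%:R * 2 ^- (2 * n) <= u * 2 ^- (2 * n) by rewrite ler_pM2r.
have : 2 ^- (2 * n) <= s ^+ 2 by rewrite qE -expr2 lerXn2r ?nnegrE// ltW.
lra.
Qed.

(** * Porosity of the set *)

Lemma squeeze_harmonic (R : realType) (u : nat -> R) :
  (forall j, 0 <= u j <= j.+1%:R^-1) -> u @ \oo --> 0.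
Proof.
move=> uj; apply: (squeeze_cvgr _ (cvg_cst 0) cvg_harmonic).
by near=> j; exact: uj.
Unshelve. all: by end_near. Qed.

(** A point of the cone in the ball of radius [s / 3] about [(0, 0, s)] would have
[|z| < s / 3] and height above [2 s / 3], contrary to [|t| <= |z|]. *)
Lemma P_e_lporous_at0 (R : realType) : lporous_at (@euclid_dist R) (@P_e R) 3^-1 0.
Proof.
have d0 (s : R) : 0 <= s -> euclid_dist (0, 0, s) 0 = s.
  by move=> s0; rewrite /euclid_dist /= !subr0 expr0n /= !add0r sqrtr_sqr ger0_norm.
have h0 j : 0 < j.+1%:R^-1 :> R by rewrite invr_gt0.
exists (fun j => (0, 0, j.+1%:R^-1)); split.
- by move=> j [] /eqP; rewrite gt_eqF.
- apply: squeeze_harmonic => j; rewrite d0 ?lexx ?andbT; exact: ltW.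
- move=> j; rewrite d0 ?ltW//; apply/seteqP; split=> // p [/= pj [Lp _]].
  have := norm2_le_euclid_dist (0, 0, j.+1%:R^-1) p.
  have := height_le_euclid_dist (0, 0, j.+1%:R^-1) p.
  have nE : norm2 (0 - p.1.1) (0 - p.1.2) = norm2 p.1.1 p.1.2.
    by rewrite /norm2 !sub0r !sqrrN.
  move: Lp pj (h0 j); rewrite /Lambda /= nE; move: (j.+1%:R^-1) => s.
  have := ler_norm p.2; have := ler_norm (s - p.2).
  lra.
Qed.

(** The holes of the set of radii, moved to the ray through [a]. *)
Lemma P_e_lporous_at_radius (R : realType) (a : R * R * R) :
  radii (norm2 a.1.1 a.1.2) ->
  lporous_at (@euclid_dist R) (@P_e R) 3^-1 a.
Proof.
case: a => -[x y] t /=; have [e1 [e2 [ne xE yE]]] := polar x y.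
have r0 : 0 <= norm2 x y := norm2_ge0 x y.
move: (norm2 x y) r0 xE yE => r r0 -> ->  rR.
have rho_ j : {rho | [/\ 0 < `|rho - r|, `|rho - r| < j.+1%:R^-1 &
    forall z, `|z - rho| < 3^-1 * `|rho - r| -> 0 < z /\ ~ radii z]}.
  by apply: cid; apply: radii_porous => //; rewrite invr_gt0.
pose rho j := sval (rho_ j).
have rhoP j : [/\ 0 < `|rho j - r|, `|rho j - r| < j.+1%:R^-1 &
    forall z, `|z - rho j| < 3^-1 * `|rho j - r| -> 0 < z /\ ~ radii z].
  exact: (svalP (rho_ j)).
have dE j : euclid_dist (rho j * e1, rho j * e2, t) (r * e1, r * e2, t) = `|rho j - r|.
  rewrite /euclid_dist /= subrr expr0n /= addr0 -!mulrBl.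
  by rewrite -/(norm2 ((rho j - r) * e1) ((rho j - r) * e2)) norm2_scale ne mulr1.
exists (fun j => (rho j * e1, rho j * e2, t)); split.
- move=> j; have [+ _ _] := rhoP j; rewrite -dE => + E; rewrite E.
  by rewrite /euclid_dist !subrr expr0n /= !addr0 sqrtr0 ltxx.
- apply: squeeze_harmonic => j; have [_ /ltW + _] := rhoP j.
  by rewrite dE normr_ge0.
- move=> j; rewrite dE; apply/seteqP; split=> // p [/= pj /P_eE[_ p0]].
  have [rj _ holej] := rhoP j.
  have rho0 : 0 <= rho j.
    have [|h _] := holej (rho j); first by rewrite subrr normr0 mulr_gt0// invr_gt0.
    exact: ltW.
  have [|z0 Nz] := holej (norm2 p.1.1 p.1.2).
    apply: le_lt_trans pj; apply: le_trans (norm2_le_euclid_dist _ _) => /=.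
    rewrite distrC -[X in `|X - _|](norm2_polar ne rho0); exact: ler_dist_norm2.
  case: p0 => [pE|//].
  by move: z0; rewrite pE /= /norm2 expr0n /= addr0 sqrtr0 ltxx.
Qed.

Lemma cc_dist_to_0_gt0 (R : realType) (p : R * R * R) : p <> 0 -> 0 < cc_dist p 0.
Proof.
move=> p0; have [h1 h2 h3] := cc_dist_to_0 p.
have d0 : 0 <= cc_dist p 0 by exact: le_trans h1.
rewrite lt_neqAle d0 andbT eq_sym; apply/eqP => dE; apply: p0.
move: h1 h2 h3; rewrite dE expr0n /= mulr0 !normr_le0.
by case: p {d0 dE} => -[x y] t /= /eqP-> /eqP-> /eqP->.
Qed.

(** The new radius is sought in [(s, s + s^2]] with [s = |z| + lambda d / 4]. The
shift by [lambda d / 4] beats the height, which is at most [4 d^2], and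
[s^2 <= (9 d / 4)^2] is below [3 lambda d / 4]; both use [d < lambda / 16]. *)
Lemma P_e_cc_near (R : realType) (p : R * R * R) (lambda : R)
    (d := cc_dist p 0) :
  0 < lambda < 1 -> p <> 0 -> d < lambda / 16 ->
  exists2 q, P_e q & cc_dist p q < lambda * d.
Proof.
move=> /andP[l0 l1] p0 dl.
have d0 : 0 < d by exact: cc_dist_to_0_gt0.
have [] := cc_dist_to_0 p; rewrite -/d.
case: p @d p0 dl d0 => -[x y] t d p0 dl d0 /= xd yd td.
have [e1 [e2 [ne xE yE]]] := polar x y.
have zd := norm2_le_add x y.
have z0 := norm2_ge0 x y.
rewrite [in cc_dist _](_ : (x, y, t) =
  (norm2 x y * e1, norm2 x y * e2, t)); last by rewrite -xE -yE.
move: (norm2 x y) zd z0 {xE yE} => z zd z0.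
have ld : 0 < lambda * d by rewrite mulr_gt0.
have ld1 : lambda * d < d by rewrite gtr_pMl.
pose s := z + lambda * d / 4.
have dd : d * d < lambda / 16 * d by rewrite ltr_pM2r.
have [s0 sd] : 0 < s /\ s < 9 / 4 * d by rewrite /s; split; lra.
have s1 : s < 1 by lra.
have ss : s ^+ 2 <= (9 / 4 * d) ^+ 2 by rewrite lerXn2r ?nnegrE; lra.
have [r rR /andP[sr rs]] := radii_dense s0 s1.
exists (r * e1, r * e2, t).
  apply/P_eE; rewrite /= norm2_polar//; last by lra.
  split; last by right.
  apply: le_trans td _; rewrite /s in sr; lra.
apply: le_lt_trans (cc_dist_radial _ _ _ ne) _.
rewrite ger0_norm; last by rewrite /s in sr; lra.
rewrite /s in rs ss; rewrite !expr2 in rs ss; lra.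
Qed.

Theorem proposition3p7 (R : realType) :
  porous (@euclid_dist R) (@P_e R) /\
  ~ porous_at (@cc_dist R) (@P_e R) (0 : (R * R * R)%type)%R.
Proof.
split.
  exists 3^-1; split; first by rewrite invr_gt0 ltr0n invf_lt1 ?ltr0n// ltr1n.
  move=> a /P_eE[_ [->|ra]]; first exact: P_e_lporous_at0.
  exact: P_e_lporous_at_radius.
move=> [lambda [l01 [x_ [xN0 x0 xP]]]].
have e0 : 0 < lambda / 16 by move: l01 => /andP[? _]; lra.
have /cvgrPdist_lt/(_ _ e0) [N _ /(_ N (leqnn N))] := x0.
rewrite /= sub0r normrN => dN.
have [q Pq dq] := P_e_cc_near l01 (xN0 N) (le_lt_trans (ler_norm _) dN).
by have : set0 q by rewrite -(xP N).
Qed.
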